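(* Let $M,K\in\mathbb{R}^{n\times n}$ be symmetric positive definite matrices, let $\nu>0$ and $\omega\ge 0$ be real numbers, and define the $2n\times 2n$ block matrices $$ \mathbf{R}=\begin{pmatrix} M & -\sqrt{\nu}K \\ \sqrt{\nu}K & M+2\sqrt{\nu}K \end{pmatrix},\qquad \mathbf{Q}=\begin{pmatrix} M & -\sqrt{\nu}(K-\mathrm{i}\omega M) \\ \sqrt{\nu}(K+\mathrm{i}\omega M) & M+2\sqrt{\nu}K \end{pmatrix}. $$ Let $S=M^{-\frac12}KM^{-\frac12}$. If $\lambda\in\mathbb{C}$ is an eigenvalue of $\mathbf{R}^{-1}\mathbf{Q}$, then $\Re(\lambda)=1$ and $$ \frac{\sqrt{\nu}\,\omega}{1+\sqrt{\nu}\,\lambda_{\max}(S)}\le|\Im(\lambda)|\le\frac{\sqrt{\nu}\,\omega}{1+\sqrt{\nu}\,\lambda_{\min}(S)}. $$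
   Context: $\mathrm{i}=\sqrt{-1}$; $\Re(z)$, $\Im(z)$ denote the real and imaginary parts of $z\in\mathbb{C}$; $\lambda_{\max}(S)$ and $\lambda_{\min}(S)$ denote the largest and smallest eigenvalues of a matrix $S$ with real eigenvalues; $M^{-1/2}$ is the inverse of the symmetric positive definite square root of $M$. (In the application, $M$ is a finite element mass matrix, $K$ is the discretized negative Laplacian, $\nu$ is a regularization parameter and $\omega$ is a frequency.) Under these assumptions the matrix $\mathbf{R}$ is nonsingular. *)

(* Defs.v *)
From mathcomp Require Import all_boot all_order all_algebra.
From mathcomp Require Import boolp classical_sets reals.
From mathcomp Require Import complex.

Set Implicit Arguments.
Unset Strict Implicit.
Unset Printing Implicit Defensive.

Import Order.TTheory GRing.Theory Num.Theory.
Local Open Scope classical_set_scope.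
Local Open Scope ring_scope.
Local Open Scope complex_scope.

Definition spdmx (R : realType) (n : nat) (A : 'M[R]_n) : Prop :=
  A^T = A /\ forall v : 'cV[R]_n, v != 0 -> 0 < (v^T *m A *m v) 0 0.

(* The set below is a singleton when [A] is symmetric positive definite;
   the default 0 is only reached for other matrices. *)
Definition sqrtmx (R : realType) (n : nat) (A : 'M[R]_n) : 'M[R]_n :=
  xget 0 [set B : 'M[R]_n | spdmx B /\ B *m B = A].

(* The default 0 is only reached when [A] has no eigenvalue in [R]; a symmetric
   matrix of positive size always has one. *)
Definition lambda_max (R : realType) (n : nat) (A : 'M[R]_n) : R :=
  xget 0 [set a : R | eigenvalue A a /\ forall b, eigenvalue A b -> b <= a].

Definition lambda_min (R : realType) (n : nat) (A : 'M[R]_n) : R :=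
  xget 0 [set a : R | eigenvalue A a /\ forall b, eigenvalue A b -> a <= b].

Definition complexmx (R : realType) (m n : nat) (A : 'M[R]_(m, n)) :
  'M[R[i]]_(m, n) := map_mx (real_complex R) A.

Definition Smx (R : realType) (n : nat) (M K : 'M[R]_n) : 'M[R]_n :=
  invmx (sqrtmx M) *m K *m invmx (sqrtmx M).

Definition Rmx (R : realType) (n : nat) (M K : 'M[R]_n) (nu : R) :
    'M[R]_(n + n) :=
  block_mx M                   (- (Num.sqrt nu *: K))
           (Num.sqrt nu *: K)  (M + (2 * Num.sqrt nu) *: K).

Definition Qmx (R : realType) (n : nat) (M K : 'M[R]_n) (nu omega : R) :
    'M[R[i]]_(n + n) :=
  let Mc := complexmx M in
  let Kc := complexmx K in
  let s : R[i] := (Num.sqrt nu)%:C in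
  let iw : R[i] := 'i%C * omega%:C in
  block_mx Mc                      (- (s *: (Kc - iw *: Mc)))
           (s *: (Kc + iw *: Mc))  (Mc + (2 * s) *: Kc).

(* Main.v *)
Require Import Defs.
From mathcomp Require Import all_boot all_order all_algebra.
From mathcomp Require Import boolp classical_sets reals complex.
From mathcomp Require Import sesquilinear spectral ring lra.

(** Write [s = sqrt nu], [N = M + s K].  An eigenvector of [R^-1 Q] yields a
    nonzero row [(a, b)] with [(a, b) (Q - R) = (lambda - 1) (a, b) R].
    Subtracting the two block equations eliminates the off-diagonal coupling:
    [w = a - b] satisfies [- i s omega w M = (lambda - 1) w N], and when [a = b]
    the row [w = a] satisfies the same equation with the opposite sign.  Pairing
    with the conjugate of [w] gives
    [lambda - 1 = +- i s omega / (1 + s rho)], where [rho] is the Rayleigh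
    quotient of [(K, M)] at [w], which lies between the extreme eigenvalues of
    [S]. *)

Set Implicit Arguments.
Unset Strict Implicit.
Unset Printing Implicit Defensive.

Import Order.TTheory GRing.Theory Num.Theory.
Local Open Scope ring_scope.

(** Newton interpolation: a new node is fitted by adding a multiple of a polynomial that vanishes at
    all earlier nodes. It later turns [Num.sqrt] on a spectrum into a polynomial. *)
Lemma poly_interpolation (F : fieldType) (f : F -> F) (s : seq F) :
  exists p : {poly F}, forall a, a \in s -> p.[a] = f a.
Proof.
elim: s => [|a s [p ps]]; first by exists 0.
have [sa|sNa] := boolP (a \in s).
  by exists p => b; rewrite inE => /predU1P[->|]; apply: ps.
pose q : {poly F} := \prod_(b <- s) ('X - b%:P).
have qa : q.[a] != 0 by rewrite -/(root q a) root_prod_XsubC.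
exists (p + ((f a - p.[a]) / q.[a])%:P * q) => b.
rewrite !hornerE inE => /predU1P[->|sb]; first by rewrite divfK // addrC subrK.
have /rootP-> : root q b by rewrite root_prod_XsubC.
by rewrite mulr0 addr0 ps.
Qed.

(** * Quadratic forms and the spectral theorem for real symmetric matrices *)

Section SymmetricMatrices.
Variable R : realType.

(** Row vectors are used because [eigenvalue] refers to left eigenvectors [u *m A = a *: u]. *)
Definition bform n (A : 'M[R]_n) (u v : 'rV[R]_n) : R := (u *m A *m v^T) 0 0.

Definition qform n (A : 'M[R]_n) (u : 'rV[R]_n) : R := bform A u u.

Lemma bformC n (A : 'M[R]_n) u v : A^T = A -> bform A u v = bform A v u.
Proof.
move=> Asym; rewrite /bform -[LHS]/((_ : 'M_1) 0 0) -[u *m A *m v^T]trmxK.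
by rewrite [LHS]mxE !trmx_mul trmxK Asym mulmxA.
Qed.

Lemma qform1E n (u : 'rV[R]_n) : qform 1%:M u = \sum_j u 0 j ^+ 2.
Proof.
by rewrite /qform /bform mulmx1 mxE; apply: eq_bigr => j _; rewrite mxE expr2.
Qed.

Lemma qform1_gt0 n (u : 'rV[R]_n) : u != 0 -> 0 < qform 1%:M u.
Proof.
move=> u0; rewrite qform1E lt_def sumr_ge0 ?andbT => [|j _]; last exact: sqr_ge0.
apply: contra u0; rewrite psumr_eq0 => [/allP u0|j _]; last exact: sqr_ge0.
apply/eqP/rowP => j; rewrite mxE; apply/eqP.
by rewrite -sqrf_eq0; apply: u0; rewrite mem_index_enum.
Qed.

Lemma eigenvector_qform n (A : 'M[R]_n) a u :
  u *m A = a *: u -> qform A u = a * qform 1%:M u.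
Proof. by rewrite /qform /bform mulmx1 => ->; rewrite -scalemxAl mxE. Qed.

Lemma trmx_horner_mx n (A : 'M[R]_n.+1) p :
  A^T = A -> (horner_mx A p)^T = horner_mx A p.
Proof.
move=> Asym; elim/poly_ind: p => [|p c IHp]; first by rewrite rmorph0 trmx0.
rewrite rmorphD rmorphM /= horner_mx_X horner_mx_C linearD /= tr_scalar_mx.
congr (_ + _); rewrite [LHS]trmx_mul Asym IHp.
exact: (comm_mx_horner p (erefl : comm_mx A A)).
Qed.

(* The functional calculus of a symmetric matrix, phrased without leaving [R]:
   the [d j] are the eigenvalues with multiplicity, and [w j] is the squared
   modulus of the [j]-th coordinate of [u] in a complex orthonormal
   eigenbasis. *)
Lemma symmetric_spectral n (A : 'M[R]_n.+1) : A^T = A ->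
  exists d : 'I_n.+1 -> R,
  [/\ forall j, eigenvalue A (d j),
      forall p : {poly R}, (forall j, p.[d j] = 0) -> horner_mx A p = 0
    & forall u, exists w : 'I_n.+1 -> R, (forall j, 0 <= w j) /\
        forall p, qform (horner_mx A p) u = \sum_j p.[d j] * w j].
Proof.
move=> Asym; pose A' := complexmx A.
have A'herm : A' \is hermsymmx.
  apply: realsym_hermsym; last first.
    by apply/mxOverP => i j; rewrite mxE; apply/complex_realP; exists (A i j).
  by apply/is_hermitianmxP; rewrite expr0 scale1r map_mx_id // /A' /complexmx map_trmx Asym.
pose U := spectralmx A'; pose d j := complex.Re (spectral_diag A' 0 j).
have Uu : U \is unitarymx := spectral_unitarymx A'.
have Uunit : U \in unitmx := spectral_unit A'.
have dE : spectral_diag A' = \row_j (real_complex R (d j)).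
  apply/rowP => j; rewrite mxE RRe_real //.
  exact: (mxOverP (hermitian_spectral_diag_real A'herm)).
have A'E : A' = invmx U *m diag_mx (\row_j (real_complex R (d j))) *m U.
  by rewrite -dE; apply/orthomx_spectralP/hermitian_normalmx.
have hornerE p : complexmx (horner_mx A p) =
    invmx U *m diag_mx (\row_j (real_complex R p.[d j])) *m U.
  have -> : \row_j (real_complex R p.[d j]) =
      map_mx (horner (map_poly (real_complex R) p)) (\row_j (real_complex R (d j))).
    by apply/rowP => j; rewrite !mxE horner_map.
  by rewrite -horner_mx_diag -(horner_mx_uconjC _ _ Uunit) -A'E [LHS]map_horner_mx.
exists d; split.
- move=> j; rewrite -(eigenvalue_map (real_complex R)) -/(complexmx A) -/A'.
  (* The rows of [U] are left eigenvectors; a zero row would make the determinant of [U] vanish. *)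
  apply/eigenvalueP; exists (row j U).
    rewrite A'E -[LHS]row_mul !mulmxA mulmxV // mul1mx row_mul row_diag_mx mxE.
    by rewrite -scalemxAl -rowE.
  by apply: contraTneq Uunit => Uj0; rewrite unitmxE (expand_det_row _ j) big1 ?unitr0 //
    => k _; move/rowP/(_ k): Uj0; rewrite !mxE => ->; rewrite mul0r.
- move=> p p0; apply: (map_mx_inj (f := real_complex R)).
  rewrite [LHS]hornerE map_mx0.
  have -> : \row_j (real_complex R p.[d j]) = 0.
    by apply/rowP => j; rewrite !mxE p0.
  by rewrite linear0 mulmx0 mul0mx.
- move=> u; pose y := complexmx u *m invmx U.
  exists (fun j => complex.Re (y 0 j) ^+ 2 + complex.Im (y 0 j) ^+ 2).
  split=> [j|p]; first by rewrite addr_ge0 ?sqr_ge0.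
  apply: (@complexI R).
  have -> : real_complex R (qform (horner_mx A p) u) =
      (complexmx u *m complexmx (horner_mx A p) *m (complexmx u)^T) 0 0.
    by rewrite /complexmx map_trmx -!map_mxM mxE.
  (* [U] is unitary and [u] is real, so conjugating [y] only turns [invmx U] into the transpose of
     [U]. *)
  have yE : U *m (complexmx u)^T = (map_mx Num.conj y)^T.
    rewrite /y invmx_unitary // map_mxM trmx_mul; congr (_ *m _).
      by rewrite -map_mx_comp map_mx_id ?trmxK // => z /=; rewrite conjCK.
    by congr (_^T); apply/rowP => j; rewrite !mxE; apply/esym/conjc_real.
  rewrite hornerE -!mulmxA yE !mulmxA -/y mxE rmorph_sum /=.
  apply: eq_bigr => j _; rewrite mul_mx_diag !mxE rmorphM /= add_Re2_Im2.
  by rewrite normCK; ring.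
Qed.

(** The forms of [A] and of the identity at [u] are the cases ['X] and [1] of the spectral sum, with
    the same nonnegative weights, so the largest [d j] bounds the Rayleigh quotient. Being also an
    eigenvalue, it shows that [xget] does not return its default. *)
Lemma lambda_max_spec n (A : 'M[R]_n.+1) : A^T = A ->
  eigenvalue A (lambda_max A) /\
  forall u, qform A u <= lambda_max A * qform 1%:M u.
Proof.
move=> /symmetric_spectral[d [dA _ dq]].
pose m := [arg max_(j > ord0) d j]%O.
have le_m j : d j <= d m by rewrite /m; case: arg_maxP => //= i _; apply.
have qm u : qform A u <= d m * qform 1%:M u.
  have [w [w0 wE]] := dq u.
  have := wE 'X; have := wE 1; rewrite rmorph1 horner_mx_X => -> ->.
  rewrite mulr_sumr ler_sum // => j _.
  by rewrite hornerX hornerC mul1r ler_wpM2r.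
suff max_m : [set a | eigenvalue A a /\ forall b, eigenvalue A b -> b <= a]%classic (d m).
  have [Amax le_max] := @xgetI _ 0 _ _ max_m; split=> // u.
  apply: le_trans (qm u) _; have [->|u0] := eqVneq u 0.
    by rewrite /qform /bform !mul0mx mxE !mulr0.
  by rewrite ler_pM2r ?qform1_gt0 ?le_max.
split=> [|b /eigenvalueP[u uA u0]]; first exact: dA.
by rewrite -(ler_pM2r (qform1_gt0 u0)) -(eigenvector_qform uA).
Qed.

Lemma lambda_min_spec n (A : 'M[R]_n.+1) : A^T = A ->
  eigenvalue A (lambda_min A) /\
  forall u, lambda_min A * qform 1%:M u <= qform A u.
Proof.
move=> /symmetric_spectral[d [dA _ dq]].
pose m := [arg min_(j < ord0) d j]%O.
have ge_m j : d m <= d j by rewrite /m; case: arg_minP => //= i _; apply.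
have qm u : d m * qform 1%:M u <= qform A u.
  have [w [w0 wE]] := dq u.
  have := wE 'X; have := wE 1; rewrite rmorph1 horner_mx_X => -> ->.
  rewrite mulr_sumr ler_sum // => j _.
  by rewrite hornerX hornerC mul1r ler_wpM2r.
suff min_m : [set a | eigenvalue A a /\ forall b, eigenvalue A b -> a <= b]%classic (d m).
  have [Amin ge_min] := @xgetI _ 0 _ _ min_m; split=> // u.
  apply: le_trans (qm u); have [->|u0] := eqVneq u 0.
    by rewrite /qform /bform !mul0mx mxE !mulr0.
  by rewrite ler_pM2r ?qform1_gt0 ?ge_min.
split=> [|b /eigenvalueP[u uA u0]]; first exact: dA.
by rewrite -(ler_pM2r (qform1_gt0 u0)) -(eigenvector_qform uA).
Qed.

(** * Positive definite matrices and their square roots *)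

Lemma spdmxP n (A : 'M[R]_n) :
  spdmx A <-> A^T = A /\ forall u, u != 0 -> 0 < qform A u.
Proof.
split=> -[Asym Apos]; split=> // u u0.
  by have := Apos u^T; rewrite trmxK trmx_eq0; apply.
by have := Apos u^T; rewrite /qform /bform trmxK trmx_eq0; apply.
Qed.

Lemma spdmx_qform_ge0 n (A : 'M[R]_n) u : spdmx A -> 0 <= qform A u.
Proof.
move=> /spdmxP[_ Apos]; have [->|/Apos/ltW//] := eqVneq u 0.
by rewrite /qform /bform !mul0mx mxE.
Qed.

(** A row in the left kernel has form zero. The criterion also covers the nonsymmetric [Rmx]. *)
Lemma qform_unitmx n (A : 'M[R]_n) :
  (forall u, u != 0 -> 0 < qform A u) -> A \in unitmx.
Proof.
move=> Apos; rewrite -row_free_unit -kermx_eq0; apply/rowV0P => u /sub_kermxP uA.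
by apply/eqP/negPn/negP => /Apos; rewrite /qform /bform uA mul0mx mxE ltxx.
Qed.

Lemma spdmx_eigenvalue_gt0 n (A : 'M[R]_n) a :
  spdmx A -> eigenvalue A a -> 0 < a.
Proof.
move=> /spdmxP[_ Apos] /eigenvalueP[u uA u0].
by have := Apos u u0; rewrite (eigenvector_qform uA) pmulr_lgt0 ?qform1_gt0.
Qed.

(* The square root is [p(A)], where [p] interpolates [Num.sqrt] on the
   spectrum. *)
Lemma sqrtmx_spec n (A : 'M[R]_n.+1) : spdmx A ->
  spdmx (sqrtmx A) /\ sqrtmx A *m sqrtmx A = A.
Proof.
move=> Aspd; have [Asym Apos] := (spdmxP A).1 Aspd.
have [d [dA dp dq]] := symmetric_spectral Asym.
have d0 j : 0 < d j := spdmx_eigenvalue_gt0 Aspd (dA j).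
have [p pE] := poly_interpolation (@Num.sqrt R) (codom d).
have {}pE j : p.[d j] = Num.sqrt (d j) by apply/pE/codom_f.
apply: (@xgetI _ 0 [set B : 'M[R]_n.+1 | spdmx B /\ B *m B = A]%classic
  (horner_mx A p)); split.
  apply/spdmxP; split=> [|u u0]; first exact: trmx_horner_mx.
  have [w [w0 wE]] := dq u; rewrite wE.
  have sw0 j : 0 <= p.[d j] * w j by rewrite pE mulr_ge0 ?sqrtr_ge0.
  rewrite lt_def sumr_ge0 ?andbT => [|j _]; last exact: sw0.
  (* If the sum vanished, every weight [w j] would be zero because [p.[d j]] is positive; their sum
     is [qform 1%:M u], which is positive. *)
  apply: contraTN (qform1_gt0 u0); rewrite psumr_eq0 => [/allP pw0|j _]; last exact: sw0.
  have := wE 1; rewrite rmorph1 => ->; rewrite big1 ?ltxx // => j _.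
  have /eqP := pw0 j (mem_index_enum j).
  rewrite pE => /eqP; rewrite mulf_eq0 sqrtr_eq0 leNgt d0 /= => /eqP->.
  by rewrite mulr0.
(* The polynomial [p * p - 'X] vanishes at every [d j], hence at [A]. *)
apply/eqP; rewrite -subr_eq0 -[X in _ - X]horner_mx_X -[_ *m _]/(_ * _).
rewrite -rmorphM -rmorphB; apply/eqP/dp => j.
by rewrite !hornerE pE -expr2 sqr_sqrtr ?subrr // ltW.
Qed.

(** * The pencil of [K] and [M], and nonsingularity of the block matrix *)

Lemma qform_congr n (P A : 'M[R]_n) u :
  qform (P *m A *m P^T) u = qform A (u *m P).
Proof. by rewrite /qform /bform trmx_mul !mulmxA. Qed.

Lemma Smx_spd n (M K : 'M[R]_n.+1) : spdmx M -> spdmx K -> spdmx (Smx M K).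
Proof.
move=> /sqrtmx_spec[/spdmxP[Bsym Bpos] _] /spdmxP[Ksym Kpos].
have Bu := qform_unitmx Bpos; have BVsym : (invmx (sqrtmx M))^T = invmx (sqrtmx M).
  by rewrite trmx_inv Bsym.
apply/spdmxP; split; first by rewrite /Smx !trmx_mul BVsym Ksym mulmxA.
move=> u u0; rewrite /Smx -{2}BVsym qform_congr Kpos //.
by apply: contra u0 => /eqP/(congr1 (mulmx^~ (sqrtmx M))); rewrite mulmxKV // mul0mx => ->.
Qed.

(** The substitution of [u *m sqrtmx M] for [u] turns the Rayleigh quotient of the pair into that of
    [Smx M K]. *)
Lemma pencil_qform_bounds n (M K : 'M[R]_n.+1) u : spdmx M -> spdmx K ->
  lambda_min (Smx M K) * qform M u <= qform K u
    <= lambda_max (Smx M K) * qform M u.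
Proof.
move=> Mspd Kspd; have [Ssym _] := (spdmxP _).1 (Smx_spd Mspd Kspd).
have [/spdmxP[Bsym /qform_unitmx Bu] BB] := sqrtmx_spec Mspd.
have qM : qform M u = qform 1%:M (u *m sqrtmx M).
  by rewrite -qform_congr mulmx1 Bsym BB.
have qK : qform K u = qform (Smx M K) (u *m sqrtmx M).
  by rewrite -qform_congr Bsym /Smx !mulmxA mulmxV // mul1mx mulmxKV.
by rewrite qM qK (lambda_max_spec Ssym).2 (lambda_min_spec Ssym).2.
Qed.

(** The off-diagonal blocks are opposite and [K] is symmetric, so the cross terms cancel in the
    quadratic form and only the positive diagonal part remains. *)
Lemma Rmx_unit n (M K : 'M[R]_n) nu : spdmx M -> spdmx K -> Rmx M K nu \in unitmx.
Proof.
move=> Mspd Kspd; apply: qform_unitmx => u.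
have [_ Mpos] := (spdmxP M).1 Mspd; have [Ksym _] := (spdmxP K).1 Kspd.
rewrite -[u]hsubmxK; move: (lsubmx u) (rsubmx u) => a b ab0.
have -> : qform (Rmx M K nu) (row_mx a b) =
    qform M a + qform M b + 2 * Num.sqrt nu * qform K b.
  rewrite /qform /bform /Rmx mul_row_block tr_row_mx mul_row_col.
  have := bformC b a Ksym; rewrite /bform.
  rewrite !mulmxDr !mulmxN -!scalemxAr !mulmxDl !mulNmx -!scalemxAl !mxE => ->.
  by ring.
rewrite ltr_wpDr ?mulr_ge0 ?sqrtr_ge0 ?spdmx_qform_ge0 //.
have [a0|/Mpos a0] := eqVneq a 0; last by rewrite ltr_wpDr ?spdmx_qform_ge0.
rewrite ltr_wpDl ?Mpos ?spdmx_qform_ge0 //.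
by apply: contra ab0 => /eqP->; rewrite a0 row_mx0.
Qed.

End SymmetricMatrices.

(** * Complex rows as pairs of real rows *)

Section ComplexRows.
Variable R : realType.

Lemma Remx_mul n (w : 'rV[R[i]]_n) (A : 'M[R]_n) :
  map_mx (@complex.Re R) (w *m complexmx A) = map_mx (@complex.Re R) w *m A.
Proof.
apply/rowP => j; rewrite !mxE.
rewrite (raddf_sum (@complex.Re R : Rcomplex R -> R)).
apply: eq_bigr => k _; rewrite !mxE; case: (w 0 k) => x y /=.
by rewrite mulr0 subr0.
Qed.

Lemma Immx_mul n (w : 'rV[R[i]]_n) (A : 'M[R]_n) :
  map_mx (@complex.Im R) (w *m complexmx A) = map_mx (@complex.Im R) w *m A.
Proof.
apply/rowP => j; rewrite !mxE.
rewrite (raddf_sum (@complex.Im R : Rcomplex R -> R)).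
apply: eq_bigr => k _; rewrite !mxE; case: (w 0 k) => x y /=.
by rewrite mulr0 add0r.
Qed.

Lemma Remx_scale n (c : R[i]) (w : 'rV[R[i]]_n) :
  map_mx (@complex.Re R) (c *: w) =
  complex.Re c *: map_mx (@complex.Re R) w - complex.Im c *: map_mx (@complex.Im R) w.
Proof. by apply/rowP => j; rewrite !mxE; case: c (w 0 j) => [? ?] [? ?]. Qed.

Lemma Immx_scale n (c : R[i]) (w : 'rV[R[i]]_n) :
  map_mx (@complex.Im R) (c *: w) =
  complex.Re c *: map_mx (@complex.Im R) w + complex.Im c *: map_mx (@complex.Re R) w.
Proof. by apply/rowP => j; rewrite !mxE; case: c (w 0 j) => [? ?] [? ?]. Qed.

(* Pairing with the conjugate of [w] shows that [mu] is purely imaginary and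
   gives it as a quotient of values of Hermitian forms. *)
Lemma imaginary_pencil n (M N : 'M[R]_n) (g : R) (mu : R[i]) (w : 'rV[R[i]]_n) :
    M^T = M -> spdmx N -> w != 0 ->
    Complex 0 g *: (w *m complexmx M) = mu *: (w *m complexmx N) ->
  exists x y : 'rV[R]_n, [/\ (x != 0) || (y != 0), complex.Re mu = 0 &
    complex.Im mu * (qform N x + qform N y) = g * (qform M x + qform M y)].
Proof.
move=> Msym Nspd w0 E; have [Nsym Npos] := (spdmxP N).1 Nspd.
pose x := map_mx (@complex.Re R) w; pose y := map_mx (@complex.Im R) w.
have xy0 : (x != 0) || (y != 0).
  rewrite -negb_and; apply: contra w0 => /andP[/eqP/rowP x0 /eqP/rowP y0].
  apply/eqP/rowP => j; move: (x0 j) (y0 j); rewrite !mxE.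
  by case: (w 0 j) => a b /= -> ->.
have := congr1 (map_mx (@complex.Im R)) E; have := congr1 (map_mx (@complex.Re R)) E.
rewrite !Remx_scale !Immx_scale !Remx_mul !Immx_mul -/x -/y /=.
rewrite scale0r sub0r scale0r add0r => ERe EIm.
have pairRe z : - (g * bform M y z) =
    complex.Re mu * bform N x z - complex.Im mu * bform N y z.
  have := congr1 (fun v => (v *m z^T) 0 0) ERe.
  by rewrite /= mulmxDl !mulNmx -!scalemxAl /bform !mxE.
have pairIm z : g * bform M x z =
    complex.Re mu * bform N y z + complex.Im mu * bform N x z.
  have := congr1 (fun v => (v *m z^T) 0 0) EIm.
  by rewrite /= mulmxDl -!scalemxAl /bform !mxE.
have N0 : 0 < qform N x + qform N y.
  have := spdmx_qform_ge0 x Nspd; have := spdmx_qform_ge0 y Nspd; case/orP: xy0 => /Npos; lra.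
exists x, y; split=> //; last first.
  (* In [pairIm x] minus [pairRe y] the terms in the real part of [mu] cancel by symmetry of [N]. *)
  have := pairRe y; have := pairIm x.
  by rewrite /qform (bformC y x Nsym) => ? ?; lra.
have : complex.Re mu * (qform N x + qform N y) = 0.
  (* In the sum of these two, the terms in [g] cancel by symmetry of [M], those in the imaginary
     part of [mu] by symmetry of [N]. *)
  have := pairRe x; have := pairIm y.
  by rewrite /qform (bformC y x Nsym) (bformC y x Msym) => ? ?; lra.
by move/eqP; rewrite mulf_eq0 (gt_eqF N0) orbF => /eqP.
Qed.

End ComplexRows.

(** Both off-diagonal blocks of [Q - R] equal [i s omega M] and its diagonal blocks vanish, so it
    exchanges the two halves of the row. The difference of the halves picks up the sign -1, and
    equal halves the sign +1; [e] records which case occurs. *)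
Lemma block_pencil_decouple (R : realType) n (M K : 'M[R]_n) (nu omega : R)
    (lambda : R[i]) (u : 'rV[R[i]]_(n + n)) : u != 0 ->
    u *m Qmx M K nu omega = lambda *: (u *m complexmx (Rmx M K nu)) ->
  exists2 w : 'rV[R[i]]_n, w != 0 & exists e : bool,
    Complex 0 ((-1) ^+ e * (Num.sqrt nu * omega)) *: (w *m complexmx M) =
    (lambda - 1) *: (w *m complexmx (M + Num.sqrt nu *: K)).
Proof.
rewrite -[u]hsubmxK; move: (lsubmx u) (rsubmx u) => a b ab0.
set s := Num.sqrt nu; pose sc := real_complex R s.
have RE : complexmx (Rmx M K nu) = block_mx (complexmx M) (- (sc *: complexmx K))
    (sc *: complexmx K) (complexmx M + (2 * sc) *: complexmx K).
  rewrite /complexmx /Rmx map_block_mx raddfN raddfD /= !map_mxZ.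
  by rewrite rmorphM /= rmorph_nat.
have NE : complexmx (M + s *: K) = complexmx M + sc *: complexmx K.
  by rewrite /complexmx raddfD /= map_mxZ.
have cE e : Complex 0 ((-1) ^+ e * (s * omega)) =
    (-1) ^+ e * (sc * (Complex 0 1 * real_complex R omega)).
  rewrite -[(-1) ^+ e in RHS](rmorph_sign (real_complex R)).
  by apply/eqP; rewrite eq_complex /=; apply/andP; split; apply/eqP; ring.
rewrite RE /Qmx -/s -/sc !mul_row_block scale_row_mx => /eq_row_mx[].
rewrite !mulmxDr !mulmxN -!scalemxAr !mulmxDr !mulmxN -!scalemxAr => E1 E2.
have [ab|ab] := eqVneq a b.
  exists a; first by apply: contra ab0 => /eqP a0; rewrite -ab a0 row_mx0.
  exists false; rewrite NE cE mulmxDr -!scalemxAr.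
  move: E1; rewrite -ab.
  move: (a *m complexmx M) (a *m complexmx K) => A Ak /matrixP E1.
  apply/matrixP => i j; move: (E1 i j); rewrite !mxE => E.
  apply/eqP; rewrite -subr_eq0; apply/eqP.
  by move/eqP: E; rewrite -subr_eq0 => /eqP <-; ring.
exists (a - b); first by rewrite subr_eq0.
exists true; rewrite NE cE mulmxDr -!scalemxAr !mulmxBl.
move: E1 E2; move: (a *m complexmx M) (a *m complexmx K) => A Ak.
move: (b *m complexmx M) (b *m complexmx K) => B Bk /matrixP E1 /matrixP E2.
apply/matrixP => i j; move: (E1 i j) (E2 i j); rewrite !mxE => {}E1 {}E2.
apply/eqP; rewrite -subr_eq0; apply/eqP.
move/eqP: E1; rewrite -subr_eq0 => /eqP E1.
move/eqP: E2; rewrite -subr_eq0 => /eqP E2.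
by rewrite -(subrr 0) -{1}E1 -E2; ring.
Qed.

Theorem theorem2 (R : realType) (n : nat) (M K : 'M[R]_n) (nu omega : R)
    (hM : spdmx M) (hK : spdmx K) (hnu : 0 < nu) (homega : 0 <= omega)
    (lambda : R[i])
    (hlambda : eigenvalue (invmx (complexmx (Rmx M K nu)) *m Qmx M K nu omega)
                 lambda) :
  complex.Re lambda = 1 /\
  Num.sqrt nu * omega / (1 + Num.sqrt nu * lambda_max (Smx M K))
    <= `|complex.Im lambda|
    <= Num.sqrt nu * omega / (1 + Num.sqrt nu * lambda_min (Smx M K)).
Proof.
case: n => [|n] in M K hM hK hlambda *.
  (* In size 0 there is no nonzero row, hence no eigenvalue. *)
  by have /eigenvalueP[v _] := hlambda; rewrite thinmx0 eqxx.
have /eigenvalueP[v vE v0] := hlambda.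
have Ru : complexmx (Rmx M K nu) \in unitmx by rewrite map_unitmx Rmx_unit.
set Rc := complexmx (Rmx M K nu) in vE Ru *.
pose u := v *m invmx Rc.
have vu : v = u *m Rc by rewrite mulmxKV.
have u0 : u != 0 by apply: contra v0 => /eqP u0; rewrite vu u0 mul0mx.
have uE : u *m Qmx M K nu omega = lambda *: (u *m Rc) by rewrite -vu -vE mulmxA.
have [w w0 [e]] := block_pencil_decouple u0 uE.
have [Msym Mpos] := (spdmxP M).1 hM; have [Ksym Kpos] := (spdmxP K).1 hK.
have s0 : 0 < Num.sqrt nu by rewrite sqrtr_gt0.
move: (Num.sqrt nu) s0 => s s0.
have qN x : qform (M + s *: K) x = qform M x + s * qform K x.
  by rewrite /qform /bform mulmxDr mulmxDl -scalemxAr -scalemxAl !mxE.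
have Nspd : spdmx (M + s *: K).
  apply/spdmxP; split=> [|x x0]; first by rewrite linearD linearZ /= Msym Ksym.
  by rewrite qN addr_gt0 ?mulr_gt0 ?Mpos ?Kpos.
move=> /(imaginary_pencil Msym Nspd w0)[x [y [xy0 Re0 Im0]]].
split; first by move: Re0; rewrite raddfB /= => /eqP; rewrite subr_eq0 => /eqP.
(* These are the Hermitian forms of [M] and [K] at [x + i y]; their quotient [k / m] is the Rayleigh
   quotient that locates the imaginary part. *)
pose m := qform M x + qform M y; pose k := qform K x + qform K y.
have m0 : 0 < m.
  have := spdmx_qform_ge0 x hM; have := spdmx_qform_ge0 y hM.
  by rewrite /m; case/orP: xy0 => /Mpos; lra.
have [/andP[minx maxx] /andP[miny maxy]] :=
  (pencil_qform_bounds x hM hK, pencil_qform_bounds y hM hK).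
have min_k : lambda_min (Smx M K) * m <= k by rewrite /m /k; lra.
have max_k : k <= lambda_max (Smx M K) * m by rewrite /m /k; lra.
have Sspd := Smx_spd hM hK.
have min0 : 0 < lambda_min (Smx M K).
  exact/(spdmx_eigenvalue_gt0 Sspd)/(lambda_min_spec Sspd.1).1.
move: (lambda_min _) (lambda_max _) min_k max_k min0 => lmin lmax min_k max_k min0.
have k0 : 0 < k by apply: lt_le_trans min_k; rewrite mulr_gt0.
have mk0 : 0 < m + s * k by rewrite addr_gt0 ?mulr_gt0.
have max0 : 0 < lmax by have := lt_le_trans k0 max_k; rewrite pmulr_lgt0.
(* Taking absolute values removes the sign left open by [e]. *)
have ImE : `|complex.Im lambda| * (m + s * k) = s * omega * m.
  have -> : complex.Im lambda = complex.Im (lambda - 1) by rewrite raddfB /= subr0.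
  rewrite -[m + _](gtr0_norm mk0) -normrM.
  have -> : complex.Im (lambda - 1) * (m + s * k) = (-1) ^+ e * (s * omega) * m.
    by rewrite -Im0 !qN /m /k; ring.
  by rewrite 2!normrM normr_sign mul1r !ger0_norm ?mulr_ge0 // ltW.
have -> : `|complex.Im lambda| = s * omega * m / (m + s * k).
  by rewrite -ImE mulfK ?gt_eqF.
have smin0 : 0 < 1 + s * lmin by rewrite addr_gt0 ?mulr_gt0.
have smax0 : 0 < 1 + s * lmax by rewrite addr_gt0 ?mulr_gt0.
have so0 : 0 <= s * omega by rewrite mulr_ge0 // ltW.
have smk : s * (lmin * m) <= s * k by rewrite ler_pM2l.
have sMk : s * k <= s * (lmax * m) by rewrite ler_pM2l.
(* The factor [s * omega], possibly zero, is split off; it remains to compare [m / (m + s * k)] with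
   the inverses of [1 + s * lmax] and [1 + s * lmin], which are the bounds on [k] after clearing
   positive denominators. *)
rewrite -[_ * m / _]mulrA; apply/andP; split; rewrite ler_wpM2l //.
  by rewrite ler_pdivlMr // [_^-1 * _]mulrC ler_pdivrMr //; lra.
by rewrite ler_pdivrMr // [_^-1 * _]mulrC ler_pdivlMr //; lra.
Qed.
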